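(* Let $K$ be a number field. The following statements hold. 1. $\mathcal{C}(T_n)=I_n$ for every non-singular (upper or lower) triangular $n\times n$ matrix $T_n$ over $K$. 2. For every such $T_n$, the set of eigenvalues of $\mathcal{C}(T_n)$ is $\Lambda(\mathcal{C}(T_n))=\{1\}$. 3. $\mathcal{C}(AB)=\mathcal{C}(A)\mathcal{C}(B)$ for all non-singular triangular $n\times n$ matrices $A,B$ over $K$.
   Context: $\circ$ denotes the Hadamard (entrywise) product; the combined matrix of a non-singular matrix $A$ is $\mathcal{C}(A)=A\circ (A^{-1})^T$. $I_n$ is the $n\times n$ identity matrix. A triangular matrix is one that is upper triangular or lower triangular.
   Formalization: In item 3, A and B are taken both upper or both lower triangular, since the claim fails for mixed pairs (A = [1 0; 1 1], B = [1 1; 0 1] gives C(AB) = [2 -1; -1 2], not I); also n is at least 1. *)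

(* Defs.v *)
From mathcomp Require Import all_boot all_algebra all_field.

Set Implicit Arguments.
Unset Strict Implicit.
Unset Printing Implicit Defensive.

Import GRing.Theory.
Local Open Scope ring_scope.

Definition hadamard (R : pzRingType) (m n : nat) (A B : 'M[R]_(m, n)) :
  'M[R]_(m, n) := map2_mx *%R A B.

(* Meaningful for invertible A only: invmx A = A when A is singular. *)
Definition combined_mx (K : fieldType) (n : nat) (A : 'M[K]_n) : 'M[K]_n :=
  hadamard A (invmx A)^T.

(* MathComp's is_trig_mx is lower triangularity. *)
Definition lower_triangular (K : fieldType) (n : nat) (A : 'M[K]_n) : bool :=
  is_trig_mx A.

Definition upper_triangular (K : fieldType) (n : nat) (A : 'M[K]_n) : bool :=
  is_trig_mx A^T.

Definition triangular (K : fieldType) (n : nat) (A : 'M[K]_n) : bool :=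
  upper_triangular A || lower_triangular A.

(* The kind must be shared: combined_mx is not multiplicative on mixed pairs;
   for A = [1 0; 1 1] and B = [1 1; 0 1] one gets
   combined_mx (A *m B) = [2 -1; -1 2], while combined_mx A, combined_mx B
   are both the identity. *)
Definition same_triangular (K : fieldType) (n : nat) (A B : 'M[K]_n) : bool :=
  (upper_triangular A && upper_triangular B)
  || (lower_triangular A && lower_triangular B).

(* The eigenvalues of A lying in the extension field L of K, K being embedded
   in L by iota. *)
Definition eigenvalues_in (K L : fieldType) (iota : {rmorphism K -> L})
    (n : nat) (A : 'M[K]_n) : pred L :=
  eigenvalue (map_mx iota A).

(* Main.v *)
Require Import Defs.
From mathcomp Require Import all_boot all_algebra all_field.

Set Implicit Arguments.
Unset Strict Implicit.
Unset Printing Implicit Defensive.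

Import GRing.Theory.
Local Open Scope ring_scope.

(** If [A] is lower triangular and invertible, so is [invmx A] ([invmx_is_trig]). Hence off the
    diagonal one factor of [A i j * (invmx A) j i] vanishes, and on it the diagonal of
    [A *m invmx A = 1] makes the product 1 ([combined_mx_lower]). Upper triangular matrices follow
    by transposing ([combined_mx_tr]). The spectrum is then that of the identity, and
    multiplicativity reads [1 = 1 * 1], since triangular matrices of one kind are closed under
    product. *)

Section LowerTriangular.

Variables (K : fieldType) (n : nat).
Implicit Types A B : 'M[K]_n.

(** The determinant is the product of the diagonal entries, and it is a unit. *)
Lemma trig_unitmx_diag_neq0 A i : is_trig_mx A -> A \in unitmx -> A i i != 0.
Proof.
move=> trigA; rewrite unitmxE (det_trig trigA) unitfE => /prodf_neq0.
exact.
Qed.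

Lemma mulmx_is_trig A B : is_trig_mx A -> is_trig_mx B -> is_trig_mx (A *m B).
Proof.
move=> /is_trig_mxP trigA /is_trig_mxP trigB; apply/is_trig_mxP => i j ltij.
rewrite mxE big1 // => k _; have [ltik|leki] := ltnP i k.
  by rewrite trigA ?mul0r.
by rewrite trigB ?mulr0 // (leq_ltn_trans leki).
Qed.

Lemma mulmx_trig_diag A B i :
  is_trig_mx A -> is_trig_mx B -> (A *m B) i i = A i i * B i i.
Proof.
move=> /is_trig_mxP trigA /is_trig_mxP trigB.
rewrite mxE (bigD1 i) //= big1 ?addr0 // => k neki.
have [ltik|ltki|/val_inj eqik] := ltngtP i k.
- by rewrite trigA ?mul0r.
- by rewrite trigB ?mulr0.
- by rewrite eqik eqxx in neki.
Qed.

Lemma invmx_is_trig A : A \in unitmx -> is_trig_mx A -> is_trig_mx (invmx A).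
Proof.
move=> unitA trigA; have /is_trig_mxP A0 := trigA.
(* Strong induction on the row [i], with the column [j] fixed: rows [k < i] also satisfy [k < j], so
   their entries in column [j] are already known to vanish. *)
apply/is_trig_mxP => i j; have [m] := ubnP (i : nat).
elim: m i => // m IHm i /ltnSE leim ltij.
(* Forward substitution: in row i of A *m invmx A = 1, only the diagonal term
   survives. *)
have /matrixP/(_ i j) := mulmxV unitA.
rewrite !mxE (bigD1 i) //= big1 => [|k neki].
  rewrite addr0 -val_eqE (ltn_eqF ltij) => /eqP.
  by rewrite mulf_eq0 (negPf (trig_unitmx_diag_neq0 i trigA unitA)) => /eqP.
have [ltik|ltki|/val_inj eqik] := ltngtP i k.
- by rewrite A0 ?mul0r.
- by rewrite IHm ?mulr0 // ?(leq_trans ltki leim) ?(ltn_trans ltki ltij).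
- by rewrite eqik eqxx in neki.
Qed.

Lemma combined_mx_lower A :
  A \in unitmx -> is_trig_mx A -> combined_mx A = 1%:M.
Proof.
move=> unitA trigA; have /is_trig_mxP A0 := trigA.
have /is_trig_mxP V0 := invmx_is_trig unitA trigA.
apply/matrixP => i j; rewrite /combined_mx /hadamard !mxE -val_eqE.
have [ltij|ltji|/val_inj <-] := ltngtP i j.
- by rewrite A0 ?mul0r.
- by rewrite V0 ?mulr0.
have /matrixP/(_ i i) := mulmxV unitA.
by rewrite mulmx_trig_diag ?invmx_is_trig // !mxE eqxx.
Qed.

End LowerTriangular.

(** Inversion commutes with transposition, and the product is entrywise. *)
Lemma combined_mx_tr (K : fieldType) n (A : 'M[K]_n) :
  combined_mx A^T = (combined_mx A)^T.
Proof. by apply/matrixP => i j; rewrite /combined_mx -trmx_inv !mxE. Qed.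

Lemma combined_mx_triangular (K : fieldType) n (A : 'M[K]_n) :
  A \in unitmx -> triangular A -> combined_mx A = 1%:M.
Proof.
move=> unitA /orP[upA|lowA]; last exact: combined_mx_lower.
by apply: trmx_inj; rewrite -combined_mx_tr trmx1 combined_mx_lower ?unitmx_tr.
Qed.

Lemma same_triangular_mul (K : fieldType) n (A B : 'M[K]_n) :
  same_triangular A B ->
  [/\ triangular A, triangular B & triangular (A *m B)].
Proof.
rewrite /triangular /upper_triangular /lower_triangular.
case/orP=> /andP[trigA trigB].
  by split; apply/orP; left=> //; rewrite trmx_mul mulmx_is_trig.
by split; apply/orP; right=> //; exact: mulmx_is_trig.
Qed.

(** Positive size supplies a nonzero vector; in size 0 the spectrum is empty. *)
Lemma eigenvalue1 (F : fieldType) n :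
  (0 < n)%N -> eigenvalue (1%:M : 'M[F]_n) =i pred1 1.
Proof.
case: n => // n _ a; rewrite !inE; apply/eigenvalueP/eqP => [[v]|->].
  (* An eigenvector satisfies [(1 - a) *: v = 0] with [v] nonzero. *)
  rewrite mulmx1 => /eqP; rewrite -subr_eq0 -{1}[v]scale1r -scalerBl.
  by rewrite scaler_eq0 subr_eq0 => /orP[/eqP->|->].
exists (const_mx 1); first by rewrite mulmx1 scale1r.
by apply/eqP => /matrixP/(_ 0 0)/eqP; rewrite !mxE oner_eq0.
Qed.

Theorem proposition7 (K : fieldExtType rat) (n : nat) (n_gt0 : (0 < n)%N) :
  [/\ forall T : 'M[K]_n, T \in unitmx -> triangular T ->
        combined_mx T = 1%:M,
      forall T : 'M[K]_n, T \in unitmx -> triangular T ->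
        forall (L : fieldType) (iota : {rmorphism K -> L}),
          eigenvalues_in iota (combined_mx T) =i pred1 1
    & forall A B : 'M[K]_n, A \in unitmx -> B \in unitmx ->
        same_triangular A B ->
        combined_mx (A *m B) = combined_mx A *m combined_mx B].
Proof.
split=> [T|T unitT trigT L iota a|A B unitA unitB trigAB].
- exact: combined_mx_triangular.
(* [iota] sends the identity over [K] to the identity over [L]. *)
- by rewrite /eigenvalues_in combined_mx_triangular // map_mx1 eigenvalue1.
- have [trigA trigB trigM] := same_triangular_mul trigAB.
  by rewrite !combined_mx_triangular ?mulmx1 // unitmx_mul unitA.
Qed.
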